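(* Let $k\ge0$ be an integer, let $\mathbf a\in C^{(k)}$ and let $(\lambda,\rho)=\iota(\mathbf a)$ with $\lambda=(\lambda_1,\dots,\lambda_n)$, $\rho=(\rho_1,\dots,\rho_n)$. Then $$\sum_{i}i a_i=\sum_{1\le i<j\le n}A_{\lambda_i,\lambda_j}+\sum_{i=1}^n\rho_i,\qquad \sum_i a_i=\sum_{i=1}^n\lambda_i .$$
   Context: A configuration is a sequence $\mathbf a=(a_i)_{i\in\mathbb Z}$ of non-negative integers; it is finite if $a_i=0$ for all but finitely many $i$. $C^{(k)}$ is the set of finite configurations with $a_i+a_{i+1}+a_{i+2}\le k$ for all $i$. Put $S[i,\mathbf a]=a_i+a_{i+1}$, $L[i,\mathbf a]=a_{i-1}+2a_i+2a_{i+1}+a_{i+2}$. For $0\le l\le k$, $C^{(k,l)}$ is the set of $\mathbf a\in C^{(k)}$ with $S[i,\mathbf a]\le l$ and $L[i,\mathbf a]\le k+l$ for all $i$ (so $C^{(k,0)}=\{\mathbf 0\}$, $C^{(k,k)}=C^{(k)}$). For $1\le l\le k$, $\underline C^{(k,l)}=C^{(k,l)}\setminus C^{(k,l-1)}$, i.e. the $\mathbf a\in C^{(k,l)}$ with $S[i,\mathbf a]=l$ or $L[i,\mathbf a]=k+l$ for some $i$. Put $A_{l,l'}=2\min(l,l')+\max(l+l'-k,0)$. A rigged partition is a pair $(\lambda,\rho)$ with $\lambda=(\lambda_1\ge\dots\ge\lambda_n\ge1)$ a partition ($n\ge 0$) and $\rho\in\mathbb Z^n$ such that $\rho_i\ge\rho_{i+1}$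 whenever $\lambda_i=\lambda_{i+1}$; $\emptyset$ denotes the one with $n=0$. Right move: for $\mathbf a\in\underline C^{(k,l)}$, $l\ge1$, let $i_1$ be the largest integer $i$ with $S[i,\mathbf a]=l$ or $L[i,\mathbf a]=k+l$; $M_+\mathbf a\in\underline C^{(k,l)}$ is obtained from $\mathbf a$ by replacing $(a_{i_1},a_{i_1+1})$ by $(a_{i_1}-1,a_{i_1+1}+1)$. $\mathbf a\in\underline C^{(k,l)}$ contains a free particle of weight $l$ at the highest position $i$ if $a_i+a_{i+1}=l$, $a_i\ne0$ and $a_j=0$ for all $j\ge i+2$. The map $\iota$ from $C^{(k)}$ to rigged partitions is defined inductively on $\sum_i a_i$: $\iota(\mathbf 0)=\emptyset$. For $\mathbf a\ne\mathbf 0$ let $l\ge1$ be the integer with $\mathbf a\in\underline C^{(k,l)}$. For all sufficiently large $t$, $M_+^t\mathbf a$ contains a free particle of weight $l$ at the highest position $i$ for some $i$; with $c=(M_+^t\mathbf a)_i$ put $d=ic+(i+1)(l-c)$ and $s=d-t$, and let $\overline{\mathbf a}$ be obtained from $M_+^t\mathbf a$ by setting the entries at columns $i,i+1$ to $0$ ($s$ and $\overline{\mathbf a}$ do not depend on $t$). If $\iota(\overline{\mathbf a})=(\overline\lambda,\overline\rho)$, then $\iota(\mathbf a)=(\lambda,\rho)$ with $\lambda=(l,\overline\lambda)$, $\rho=(\rho_1,\overline\rho)$, $\rho_1=s-\sum_jA_{l,\overline\lambda_j}$. *)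

(* Defs.v *)
From HB Require Import structures.
From mathcomp Require Import all_boot all_order all_algebra finmap.
From mathcomp Require Import boolp classical_sets.

Set Implicit Arguments.
Unset Strict Implicit.
Unset Printing Implicit Defensive.

Import GRing.Theory.
Local Open Scope classical_set_scope.
Local Open Scope ring_scope.

Definition config := {fsfun int -> nat with 0%N}.

Definition config0 : config := [fsfun].

Definition S_pair (i : int) (a : config) : nat := (a i + a (i + 1)%R)%N.

Definition L_quad (i : int) (a : config) : nat :=
  (a (i - 1)%R + 2 * a i + 2 * a (i + 1)%R + a (i + 2)%R)%N.

Definition confs (k : nat) : set config :=
  [set a | forall i : int, (a i + a (i + 1)%R + a (i + 2)%R <= k)%N].

Definition confs2 (k l : nat) : set config :=
  [set a | confs k a /\ forall i : int, (S_pair i a <= l)%N /\ (L_quad i a <= k + l)%N].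

Definition confs_strict (k l : nat) : set config :=
  [set a | (1 <= l <= k)%N /\ (confs2 k l `\` confs2 k l.-1) a].

(* The truncated subtraction computes max(l + l' - k, 0). *)
Definition A_coef (k l l' : nat) : nat := (2 * minn l l' + (l + l' - k))%N.

(* [xget x0 P] chooses an element of P and is x0 when P is empty.  Below, P is
   always a nonempty set in the cases that matter: it is a singleton, except
   in [free_time], where the choice has no influence on [iota_map]. *)

Definition saturated (k l : nat) (a : config) : set int :=
  [set i | S_pair i a = l \/ L_quad i a = (k + l)%N].

Definition last_saturated (k l : nat) (a : config) : int :=
  xget 0 [set i | saturated k l a i /\
                  forall j, saturated k l a j -> (j <= i)%R].

(* [a i1] is positive when [a] lies in [confs_strict k l], so [.-1] really
   removes one unit there. *)
Definition right_move (k l : nat) (a : config) : config :=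
  let i1 := last_saturated k l a in
  [fsfun a with i1 |-> (a i1).-1, (i1 + 1)%R |-> (a (i1 + 1)%R).+1].

Definition free_particle (l : nat) (i : int) (a : config) : Prop :=
  [/\ S_pair i a = l, a i <> 0%N & forall j : int, (i + 2 <= j)%R -> a j = 0%N].

Definition level (k : nat) (a : config) : nat := xget 0%N [set l | confs_strict k l a].

Definition free_time (k l : nat) (a : config) : nat :=
  xget 0%N [set T | forall t : nat, (T <= t)%N ->
                    exists i, free_particle l i (iter t (right_move k l) a)].

Definition free_position (l : nat) (a : config) : int :=
  xget 0 [set i | free_particle l i a].

Definition weight (a : config) : nat := (\sum_(i <- finsupp a) a i)%N.

(* A rigged partition (lambda, rho) of length n is the sequence of the n pairs
   (lambda_i, rho_i); its ordering conditions (which the values of [iota_map] on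
   [confs k] satisfy) are not part of the type.  The recursive call is on a configuration of weight
   [weight a - l], so [weight a] units of fuel are never exhausted before the
   zero configuration is reached. *)
Fixpoint iota_map_rec (fuel k : nat) (a : config) : seq (nat * int) :=
  if a == config0 then [::] else
  if fuel isn't fuel'.+1 then [::] else
  let l := level k a in
  let t := free_time k l a in
  let b := iter t (right_move k l) a in
  let i := free_position l b in
  let c := b i in
  let d : int := i * c%:Z + (i + 1) * (l%:Z - c%:Z) in
  let s : int := d - t%:Z in
  let abar : config := [fsfun b with i |-> 0%N, (i + 1)%R |-> 0%N] in
  let r := iota_map_rec fuel' k abar in
  (l, s - \sum_(q <- r) (A_coef k l q.1)%:Z) :: r.

Definition iota_map (k : nat) (a : config) : seq (nat * int) :=
  iota_map_rec (weight a) k a.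

(* Main.v *)
Require Import Defs.
From mathcomp Require Import all_boot all_order all_algebra finmap.
From mathcomp Require Import boolp classical_sets.
From mathcomp Require Import zify ring.

(** Both identities are conservation laws for the recursion that defines
    [iota_map].  Call [\sum_i a_i] the weight and [\sum_i i * a_i] the moment.

    A right move carries one unit from column [i] to column [i + 1], so it keeps
    the weight and raises the moment by 1 ([pairing_right_move]).  After [t]
    moves the free particle sits at columns [i] and [i + 1], where it accounts
    for weight [l] and moment [d = i c + (i + 1) (l - c)]; erasing it subtracts
    exactly these ([pairing_removal]).  Hence one step of the recursion lowers
    the weight by [l] and the moment by [s = d - t].  On the other side,
    prepending the row [(l, s - \sum_j A_{l, lambda_j})] to a rigged partition
    adds [l] to its size, and to its energy it adds
    [\sum_j A_{l, lambda_j} + s - \sum_j A_{l, lambda_j} = s]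
    ([rigged_energy_cons]).  Induction finishes the proof.

    The work lies in showing that the recursion never breaks down.  A nonzero
    configuration has a level ([level_strict]); the right move removes a unit
    that is present ([last_saturated_gt0]) and preserves [confs_strict k l]
    ([right_move_strict]); and a free particle appears for all large times
    ([free_particle_eventually]).  For the last point, let [i1] be the last
    saturated index.  It never decreases, because the move leaves [S] and [L]
    at [i1] unchanged, and it cannot stay put forever, because each move at [i1]
    consumes a unit of column [i1].  So [i1] runs past the support of the
    initial configuration; from then on all columns from [i1 + 2] on are empty,
    and saturation at [i1] forces [S] to equal [l] there. *)

Set Implicit Arguments.
Unset Strict Implicit.
Unset Printing Implicit Defensive.

Import Order.TTheory GRing.Theory Num.Theory.
Local Open Scope ring_scope.

(* Values of configurations are atoms for linear arithmetic: comparing two of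
   them by unfolding finite maps is prohibitively slow. *)
Local Opaque fun_of_fsfun.

(** * Weight and moment as pairings *)

(** The weight is the pairing with the constant function 1 and the moment is
    the pairing with the identity, so one computation serves both. *)
Definition pairing (f : int -> int) (a : config) : int :=
  \sum_(i <- finsupp a) f i * (a i)%:Z.

(** Right moves and the removal of a particle both act on two adjacent columns;
    this lemma accounts for both. *)
Lemma pairing_sub (f : int -> int) (a b : config) (i : int) :
  (forall j, j != i -> j != i + 1 -> a j = b j) ->
  pairing f a - pairing f b =
    f i * ((a i)%:Z - (b i)%:Z) + f (i + 1) * ((a (i + 1))%:Z - (b (i + 1))%:Z).
Proof.
(* Any common finite set of columns containing both supports and the two
   modified columns will do. *)
move=> ab; pose U := (i |` ((i + 1)%R |` (finsupp a `|` finsupp b)))%fset.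
have toU c : (finsupp c `<=` U)%fset -> pairing f c = \sum_(j <- U) f j * (c j)%:Z.
  move=> sub; apply: big_fset_incl => // x _; rewrite memNfinsupp => /eqP ->.
  by rewrite mulr0.
rewrite (toU a) ?(toU b); first last.
- by apply/fsubsetP => x xa; rewrite !inE xa !orbT.
- by apply/fsubsetP => x xa; rewrite !inE xa !orbT.
rewrite -sumrB (big_fsetD1 i) ?inE ?eqxx //=.
rewrite (big_fsetD1 (i + 1)) ?inE ?eqxx ?orbT ?andbT //=; last by lia.
rewrite big_seq big1 ?addr0 ?mulrBr // => j; rewrite !inE => /and3P[j1 ji _].
by rewrite ab ?subrr.
Qed.

Lemma weightE (a : config) : (weight a)%:Z = pairing (fun=> 1) a.
Proof.
rewrite /weight /pairing -natz natr_sum; apply: eq_bigr => i _.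
by rewrite natz mul1r.
Qed.

Lemma pairing0 f : pairing f config0 = 0.
Proof. by rewrite /pairing finsupp0 big_seq_fset0. Qed.

Lemma config_bounded (a : config) :
  exists N : nat, forall j : int, a j <> 0%N -> `|j| <= N%:Z.
Proof.
exists (\sum_(i <- finsupp a) `|i|)%N => j /eqP aj.
have ja : j \in finsupp a by rewrite mem_finsupp.
rewrite (big_fsetD1 j) //=; lia.
Qed.

(** * The level of a configuration *)

Lemma shiftE (i : int) :
  (i - 1 + 1 = i) * (i - 1 + 2 = i + 1) * (i + 1 + 1 = i + 2)
  * (i + 1 + 2 = i + 3) * (i + 1 - 1 = i).
Proof. by do !split; ring. Qed.

(** [L] at [i] is the sum of the two triples starting at [i - 1] and at [i]. *)
Lemma confs2_diag (k : nat) (a : config) : confs k a -> confs2 k k a.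
Proof.
move=> ka; split=> // i; have := ka i; have := ka (i - 1).
by rewrite /S_pair /L_quad /= !(shiftE i); lia.
Qed.

(** The least [l] with [a] in [confs2 k l] is a level: it is at most [k] by
    [confs2_diag], and positive because [confs2 k 0] contains only the zero
    configuration. *)
Lemma level_strict (k : nat) (a : config) :
  confs k a -> a <> config0 -> confs_strict k (level k a) a.
Proof.
move=> ka a0; rewrite /level.
apply: (@xgetPex _ _ (fun l => confs_strict k l a)).
have exl : exists l, `[< confs2 k l a >] by exists k; apply/asboolP/confs2_diag.
case: (ex_minnP exl) => l /asboolP la minl.
have lk : (l <= k)%N by apply/minl/asboolP/confs2_diag.
have l0 : (0 < l)%N.
  case: l la {minl lk} => // -[_ la]; case: a0; apply/fsfunP => i.
  rewrite /config0 fsfun0E; have [] := la i; rewrite /S_pair; lia.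
exists l; split; first by rewrite l0.
split=> // /asboolP /minl; lia.
Qed.

(** * Right moves *)

Section RightMove.

Variables (k l : nat).

Lemma saturated_bounded (a : config) : (0 < l)%N ->
  exists N : nat, forall j, saturated k l a j -> `|j| <= N%:Z.
Proof.
move=> l0; have [N aN] := config_bounded a; exists (N + 2)%N => j sj.
have : [|| a (j - 1)%R != 0, a j != 0, a (j + 1)%R != 0 | a (j + 2)%R != 0]%N.
  by case: sj; rewrite /S_pair /L_quad; lia.
by case/or4P => /eqP/aN; lia.
Qed.

(** Both quantities are bounded above in [confs2 k l], so failing a bound of
    [confs2 k l.-1] means reaching the bound of [confs2 k l]. *)
Lemma saturated_ex (a : config) : confs_strict k l a ->
  exists i, saturated k l a i.
Proof.
case=> /andP[l0 lk] [[ka la] nla]; apply: contrapT => nex; apply: nla; split=> // i.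
have [Sl Ll] := la i; have ns : ~ saturated k l a i by move=> ?; apply: nex; exists i.
have nS : S_pair i a <> l by move=> ?; apply: ns; left.
have nL : L_quad i a <> (k + l)%N by move=> ?; apply: ns; right.
lia.
Qed.

Lemma last_saturatedP (a : config) : confs_strict k l a ->
  saturated k l a (last_saturated k l a) /\
  forall j, saturated k l a j -> j <= last_saturated k l a.
Proof.
move=> sa; rewrite /last_saturated.
apply: (@xgetPex _ _ (fun i => saturated k l a i /\
  forall j, saturated k l a j -> j <= i)).
have [N bN] : exists N : nat, forall j, saturated k l a j -> `|j| <= N%:Z.
  by apply: saturated_bounded; case: sa => /andP[].
have [i0 si0] := saturated_ex sa.
(* Searching downwards from the upper bound N, the first hit is the largest. *)
have exn : exists n : nat, `[< saturated k l a (N%:Z - n%:Z) >].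
  exists (absz (N%:Z - i0)); apply/asboolP.
  by have := bN _ si0 => ?; rewrite (_ : N%:Z - _ = i0) //; lia.
case: (ex_minnP exn) => n /asboolP sn minn; exists (N%:Z - n%:Z); split=> // j sj.
have := bN _ sj => jN; have : (n <= absz (N%:Z - j))%N.
  by apply: minn; apply/asboolP; rewrite (_ : N%:Z - _ = j) //; lia.
by lia.
Qed.

Lemma unsaturated (a : config) (j : int) :
  confs_strict k l a -> last_saturated k l a < j ->
  (S_pair j a < l)%N /\ (L_quad j a < k + l)%N.
Proof.
move=> sa ij; have [_ maxi] := last_saturatedP sa.
have ns : ~ saturated k l a j by move=> /maxi; lia.
have [Sl Ll] := (sa.2.1.2 j).
have nS : S_pair j a <> l by move=> ?; apply: ns; left.
have nL : L_quad j a <> (k + l)%N by move=> ?; apply: ns; right.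
lia.
Qed.

(** If column [i] were empty, saturation at [i] would force [S] at [i + 1] to
    reach [l]: at once when [S] is saturated at [i], and after subtracting the
    triple at [i - 1] from [L] when [L] is.  Then [i] would not be the last
    saturated index. *)
Lemma last_saturated_gt0 (a : config) :
  confs_strict k l a -> (0 < a (last_saturated k l a))%N.
Proof.
move=> sa; have [si _] := last_saturatedP sa; set i := last_saturated k l a in si *.
have [] := unsaturated (j := i + 1) sa; first by rewrite /i; lia.
have := sa.2.1.1 (i - 1).
case: si; rewrite /S_pair /L_quad.
all: rewrite !(shiftE i); lia.
Qed.

(** Additive form of the move, with the Boolean tests read as 0 or 1, so that
    linear arithmetic covers every position of [j] relative to the move. *)
Lemma right_moveE (a : config) (j : int) : confs_strict k l a ->
  (right_move k l a j + (j == last_saturated k l a)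
   = a j + (j == last_saturated k l a + 1)%R)%N.
Proof.
move=> /last_saturated_gt0; rewrite /right_move.
set i := last_saturated k l a => ai; rewrite !fsfun_withE.
by case: eqP => [->|_]; case: eqP => [?|_]; subst; lia.
Qed.

(** This is the only triple that a move at [i] enlarges.  [L] at [i + 1] is the
    sum of the triples starting at [i] and at [i + 1].  Saturation at [i] makes
    the former at least [l]: it contains [S] at [i], and it is also what is left
    of [L] at [i] after subtracting the triple at [i - 1].  If the latter were
    [k], then [L] at [i + 1] would reach [k + l] and [i + 1] would be
    saturated. *)
Lemma right_move_triple (a : config) (i := last_saturated k l a) :
  confs_strict k l a ->
  (a (i + 1)%R + a (i + 2)%R + a (i + 3)%R < k)%N.
Proof.
move=> sa; have [si _] := last_saturatedP sa; rewrite -/i in si.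
have [] := unsaturated (j := i + 1) sa; first by rewrite /i; lia.
have := sa.2.1.1 (i - 1); have := sa.2.1.1 (i + 1).
case: si; rewrite /S_pair /L_quad.
all: rewrite !(shiftE i); lia.
Qed.

Lemma right_move_confs (a : config) :
  confs_strict k l a -> confs k (right_move k l a).
Proof.
move=> sa j; have := sa.2.1.1 j.
have Ej := right_moveE _ sa; have := Ej j; have := Ej (j + 1); have := Ej (j + 2).
set i := last_saturated k l a.
have [->|ji] := eqVneq j (i + 1); last by lia.
have := right_move_triple sa; rewrite -/i /=.
rewrite !(shiftE i); lia.
Qed.

(** Moving a unit from [i] to [i + 1] raises [S] and [L] by at most 1, and only
    at indices beyond [i], where both are below their bounds; at [i] itself both
    are unchanged, so [i] remains saturated. *)
Lemma right_move_strict (a : config) :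
  confs_strict k l a -> confs_strict k l (right_move k l a).
Proof.
move=> sa; split; first exact: sa.1.
have Ej := right_moveE _ sa; set i := last_saturated k l a in Ej *.
split; first split; first exact: right_move_confs.
  move=> j; have := sa.2.1.2 j; have := @unsaturated _ j sa; rewrite -/i.
  have := Ej (j - 1); have := Ej j; have := Ej (j + 1); have := Ej (j + 2).
  rewrite /S_pair /L_quad => ? ? ? ? ns [? ?].
  have [/ns|] := ltP i j; lia.
case=> _ /(_ i); case: (last_saturatedP sa) => si _; move: si; rewrite -/i.
have := Ej (i - 1); have := Ej i; have := Ej (i + 1); have := Ej (i + 2).
have := sa.1; rewrite /saturated /S_pair /L_quad /= => ? ? ? ? ?.
by case; lia.
Qed.

Lemma last_saturated_move (a : config) : confs_strict k l a ->
  last_saturated k l a <= last_saturated k l (right_move k l a).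
Proof.
move=> sa; have [_] := last_saturatedP (right_move_strict sa); apply.
have [si _] := last_saturatedP sa; move: si.
set i := last_saturated k l a; have Ej := right_moveE _ sa; rewrite -/i in Ej.
have := Ej (i - 1); have := Ej i; have := Ej (i + 1); have := Ej (i + 2).
rewrite /saturated /S_pair /L_quad /= => ? ? ? ?.
by case => ?; [left|right]; lia.
Qed.

Lemma pairing_right_move (f : int -> int) (a : config)
    (i := last_saturated k l a) : confs_strict k l a ->
  pairing f (right_move k l a) = pairing f a + f (i + 1) - f i.
Proof.
move=> sa; have Ej := right_moveE _ sa; rewrite -/i in Ej.
have := @pairing_sub f (right_move k l a) a i.
have -> : (right_move k l a i)%:Z - (a i)%:Z = -1 by have := Ej i; lia.
have -> : (right_move k l a (i + 1))%:Z - (a (i + 1))%:Z = 1.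
  by have := Ej (i + 1); lia.
move=> E; rewrite -[LHS](subrK (pairing f a)) E; first by ring.
by move=> j; have := Ej j; lia.
Qed.

Local Notation iterM t a := (iter t (right_move k l) a).

Lemma iter_strict t (a : config) :
  confs_strict k l a -> confs_strict k l (iterM t a).
Proof. by elim: t => //= t IH /IH/right_move_strict. Qed.

Lemma iter_weight t (a : config) :
  confs_strict k l a -> weight (iterM t a) = weight a.
Proof.
move=> sa; elim: t => //= t IH; apply/eqP; rewrite -IH -eqz_nat !weightE.
by rewrite pairing_right_move ?addrK //; apply: iter_strict.
Qed.

Lemma iter_moment t (a : config) : confs_strict k l a ->
  pairing id (iterM t a) = pairing id a + t%:Z.
Proof.
move=> sa; elim: t => /= [|t IH]; first by rewrite addr0.
by rewrite pairing_right_move ?IH //; [lia|apply: iter_strict].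
Qed.

Lemma last_saturated_iter t (a : config) : confs_strict k l a ->
  last_saturated k l a <= last_saturated k l (iterM t a).
Proof.
move=> sa; elim: t => //= t IH; apply: le_trans IH _.
exact/last_saturated_move/iter_strict.
Qed.

(** Moves only touch columns up to [i1 + 1], and [i1] never decreases. *)
Lemma iter_right_of (j : int) t (a : config) : confs_strict k l a ->
  last_saturated k l (iterM t a) + 2 <= j -> iterM t a j = a j.
Proof.
move=> sa; elim: t => //= t IH lej.
have st := iter_strict t sa.
have := last_saturated_move st; have := right_moveE j st.
by move=> Ej mono; rewrite -IH; lia.
Qed.

(** As long as the last saturated index stays the same, each move takes a unit
    from that column; the induction is on the number of units there. *)
Lemma last_saturated_increases (a : config) : confs_strict k l a ->
  exists t, last_saturated k l a < last_saturated k l (iterM t a).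
Proof.
move: {2}(a _) (leqnn (a (last_saturated k l a))) => n.
elim: n a => [|n IH] a le_n sa; first by have := last_saturated_gt0 sa; lia.
have := last_saturated_move sa; rewrite le_eqVlt => /orP[/eqP eqi|]; last by exists 1%N.
have [||t lt_t] := IH (right_move k l a).
- by rewrite -eqi; have := right_moveE (last_saturated k l a) sa; rewrite eqxx; lia.
- exact: right_move_strict.
by exists t.+1; rewrite iterSr eqi.
Qed.

Lemma last_saturated_unbounded (a : config) (B : int) : confs_strict k l a ->
  exists T, forall t, (T <= t)%N -> B <= last_saturated k l (iterM t a).
Proof.
move=> sa; suff [T leT] : exists T, B <= last_saturated k l (iterM T a).
  exists T => t Tt; rewrite -(subnK Tt) iterD; apply: le_trans leT _.
  exact/last_saturated_iter/iter_strict.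
suff [T] : exists T, last_saturated k l a + `|B - last_saturated k l a|%N%:Z
    <= last_saturated k l (iterM T a) by move=> ?; exists T; lia.
elim: `|_|%N => [|m [T IH]]; first by exists 0%N; rewrite addr0.
have [t lt_t] := last_saturated_increases (iter_strict T sa).
by exists (t + T)%N; rewrite iterD; lia.
Qed.

(** Once [i], the last saturated index, is beyond the initial support, the
    columns from [i + 2] on are empty.  If [L] is the saturated quantity at [i],
    subtracting the triple at [i - 1], which is at most [k], from [L = k + l]
    leaves [S >= l]. *)
Lemma free_particle_eventually (a : config) : confs_strict k l a ->
  exists T, forall t, (T <= t)%N -> exists i, free_particle l i (iterM t a).
Proof.
move=> sa; have [N aN] := config_bounded a.
have [T leT] := last_saturated_unbounded N%:Z sa.
exists T => t /leT lei; have st := iter_strict t sa.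
exists (last_saturated k l (iterM t a)); have [si _] := last_saturatedP st.
have := last_saturated_gt0 st.
set b := iterM t a in st si lei *; set i := last_saturated k l b in si lei *.
have b0 j : i + 2 <= j -> b j = 0%N.
  move=> ij; rewrite iter_right_of //; have [//|/eqP/aN] := eqVneq (a j) 0%N; lia.
move=> bi; split; [|by lia|by []].
case: si => //; have [Sl _] := st.2.1.2 i; have := st.2.1.1 (i - 1).
have := b0 (i + 2) (lexx _); move: Sl; rewrite /S_pair /L_quad.
rewrite !(shiftE i); lia.
Qed.

Lemma free_particle_reached (a : config) : confs_strict k l a ->
  let b := iterM (free_time k l a) a in free_particle l (free_position l b) b.
Proof.
move=> sa b; apply: (@xgetPex _ _ (fun i => free_particle l i b)).
have /xgetPex free := free_particle_eventually sa.
exact: (free 0%N _ (leqnn _)).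
Qed.

End RightMove.

(** * Removing a particle *)

Section Removal.
Variables (b : config) (i : int).
Let bbar : config := [fsfun b with i |-> 0%N, (i + 1)%R |-> 0%N].

Lemma removalE j : bbar j = if (j == i) || (j == i + 1) then 0%N else b j.
Proof. by rewrite !fsfun_withE; case: (j == i); case: (j == i + 1). Qed.

Lemma removal_confs k : confs k b -> confs k bbar.
Proof.
move=> kb j; have := kb j => /=.
have le x : (bbar x <= b x)%N by rewrite removalE; case: ifP.
by have := le j; have := le (j + 1); have := le (j + 2); lia.
Qed.

Lemma pairing_removal f :
  pairing f b = pairing f bbar + f i * (b i)%:Z + f (i + 1) * (b (i + 1))%:Z.
Proof.
have := @pairing_sub f b bbar i; rewrite !removalE !eqxx orbT !subr0 => E.
rewrite -addrA -E; first by rewrite addrC subrK.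
by move=> j; rewrite removalE => /negPf-> /negPf->.
Qed.

End Removal.

(** * Conservation along the recursion *)

Definition rigged_energy (k : nat) (r : seq (nat * int)) : int :=
  \sum_(i < size r) \sum_(j < size r | (i < j)%N)
     (A_coef k (nth (0%N, 0) r i).1 (nth (0%N, 0) r j).1)%:Z
  + \sum_(i < size r) (nth (0%N, 0) r i).2.

Lemma rigged_energy_cons k p r :
  rigged_energy k (p :: r) =
    p.2 + \sum_(q <- r) (A_coef k p.1 q.1)%:Z + rigged_energy k r.
Proof.
rewrite /rigged_energy /= !big_ord_recl /= big_mkcond big_ord_recl /= add0r.
rewrite (big_nth (0%N, 0)) big_mkord.
under [X in _ + X + _ = _]eq_bigr => i _ do rewrite big_mkcond big_ord_recl /= add0r -big_mkcond.
by rewrite /=; ring.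
Qed.

Definition rigged_weight (r : seq (nat * int)) : nat :=
  (\sum_(i < size r) (nth (0%N, 0%R) r i).1)%N.

(** Since the level is positive, the weight strictly decreases at each step, so
    fuel bounding the weight suffices. *)
Lemma iota_map_rec_conserves (fuel k : nat) (a : config) :
  confs k a -> (weight a <= fuel)%N ->
  pairing id a = rigged_energy k (iota_map_rec fuel k a) /\
  weight a = rigged_weight (iota_map_rec fuel k a).
Proof.
elim: fuel a => [|fuel IH] a ka /=; case: (eqVneq a config0) => [->|/eqP a0] wa.
- rewrite pairing0 /rigged_energy /rigged_weight !big_ord0.
  by split=> //; apply/eqP; rewrite -eqz_nat weightE pairing0.
- case: a0; apply/fsfunP => j; rewrite /config0 fsfun0E.
  have [ja|] := boolP (j \in finsupp a); last by rewrite memNfinsupp => /eqP.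
  by move: wa; rewrite /weight (big_fsetD1 j) //=; lia.
- rewrite pairing0 /rigged_energy /rigged_weight !big_ord0.
  by split=> //; apply/eqP; rewrite -eqz_nat weightE pairing0.
have sa := level_strict ka a0; set l := level k a in sa *.
set t := free_time k l a; set b := iter t _ a.
have [Sl _ _] : free_particle l (free_position l b) b by exact: free_particle_reached.
set i := free_position l b in Sl *.
set bbar : config := [fsfun b with i |-> 0%N, (i + 1)%R |-> 0%N].
have sb : confs_strict k l b by exact: iter_strict.
have wb : (weight a = weight bbar + l)%N.
  apply/eqP; rewrite -(iter_weight t sa) -/b -eqz_nat PoszD !weightE.
  rewrite (pairing_removal b i) !mul1r -addrA -PoszD.
  by move: Sl; rewrite /S_pair => ->.
have [||eE eW] := IH bbar.
- exact: removal_confs sb.2.1.1.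
- by case: (sa) => /andP[l0 _] _; lia.
split.
  rewrite rigged_energy_cons /= subrK -eE.
  have := iter_moment t sa; rewrite -/b (pairing_removal b i) -/bbar /= => E.
  have -> : l%:Z - (b i)%:Z = (b (i + 1))%:Z by move: Sl; rewrite /S_pair; lia.
  by rewrite -[LHS](addrK t%:Z) -E; ring.
by rewrite /rigged_weight /= big_ord_recl /= wb eW addnC.
Qed.

Theorem proposition3p4 (k : nat) (a : config) (ha : confs k a) :
  let r := iota_map k a in
  let n := size r in
  let lambda (i : 'I_n) : nat := (nth (0%N, 0) r i).1 in
  let rho (i : 'I_n) : int := (nth (0%N, 0) r i).2 in
  \sum_(i <- finsupp a) i * (a i)%:Z
    = \sum_(i < n) \sum_(j < n | (i < j)%N) (A_coef k (lambda i) (lambda j))%:Z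
      + \sum_(i < n) rho i
  /\ (\sum_(i <- finsupp a) a i = \sum_(i < n) lambda i)%N.
Proof. exact: iota_map_rec_conserves ha (leqnn _). Qed.
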